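(* Let $0<l_2\le l_1$ be real numbers, and put $$c^*=\tfrac12\left(l_1+l_2+\sqrt{l_1^2+l_2^2-l_1l_2}\right),\qquad c^{**}=\tfrac12\sqrt{l_1^2+l_2^2}.$$ If $c^{**}<x<c^*$, then there exists a unique triangle $ABC$ with $l_a=l_2$, $l_b=l_1$ and side $c=AB=x$. If $x$ does not lie in this interval, no such triangle exists.
   Context: For a non-degenerate triangle $ABC$ in the Euclidean plane, $a=BC$, $b=CA$, $c=AB$ are its side lengths; $l_a$ and $l_b$ denote the lengths of the internal angle bisectors drawn from $A$ and $B$ respectively, measured from the vertex to the opposite side. Uniqueness of triangles is understood up to congruence respecting the vertex labels. *)

(* Defs.v *)
From Stdlib Require Import Reals.
Open Scope R_scope.

Definition point : Type := (R * R)%type.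

Definition distance (P Q : point) : R := dist_euc (fst P) (snd P) (fst Q) (snd Q).

(* Inner product of the vectors PQ and PS. *)
Definition dot (P Q S : point) : R :=
  (fst Q - fst P) * (fst S - fst P) + (snd Q - snd P) * (snd S - snd P).

(* Unoriented angle QPS in [0, PI], with vertex P; meaningful when Q and S
   both differ from P. *)
Definition angle (Q P S : point) : R :=
  acos (dot P Q S / (distance P Q * distance P S)).

Definition collinear (A B C : point) : Prop :=
  (fst B - fst A) * (snd C - snd A) - (snd B - snd A) * (fst C - fst A) = 0.

Definition nondegenerate (A B C : point) : Prop := ~ collinear A B C.

Definition on_segment (P Q D : point) : Prop :=
  exists t : R, 0 <= t <= 1 /\
    D = ((1 - t) * fst P + t * fst Q, (1 - t) * snd P + t * snd Q).

(* l is the length of the internal bisector from A in triangle ABC.  For a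
   non-degenerate triangle the foot D, hence l, exists and is unique; D then
   differs from A, so both angles are genuine. *)
Definition bisector_length (A B C : point) (l : R) : Prop :=
  exists D : point,
    on_segment B C D /\ angle B A D = angle D A C /\ distance A D = l.

(* A distance-preserving self-map of the Euclidean plane is automatically
   bijective; orientation-reversing isometries are allowed. *)
Definition isometry (f : point -> point) : Prop :=
  forall P Q : point, distance (f P) (f Q) = distance P Q.

Definition congruent_triangles (A B C A' B' C' : point) : Prop :=
  exists f : point -> point, isometry f /\ f A = A' /\ f B = B' /\ f C = C'.

Definition triangle_with (la lb c : R) (A B C : point) : Prop :=
  nondegenerate A B C /\ bisector_length A B C la /\ bisector_length B C A lb /\
  distance A B = c.

(* Main.v *)
(* By Stewart's theorem the bisector conditions amount to
     l_a^2 (b+c)^2 = b c ((b+c)^2 - a^2)  and  l_b^2 (a+c)^2 = a c ((a+c)^2 - b^2).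
   For fixed l_a and c the first is a curve a = g(b) of slope greater than 1, and the second
   likewise a curve b = h(a) of slope greater than 1, so the two meet at most once.  With
   d = b+c-a and e = a+c-b, d + e = 2c, a triangle satisfies
     l_a^2 < 2cd  and  d < 2c l_a / (2c - l_a)  (when l_a < 2c),
   and the same for l_b and e.  Adding, l_a^2 + l_b^2 < 4c^2 and
   4c^2 - 4c(l_a + l_b) + 3 l_a l_b < 0, which is c** < c < c*.  Conversely, under these
   inequalities h(g(b)) - b changes sign between the degenerate position a = |c - b| and
   b = +oo, so the curves meet. *)
Require Import Defs.
From Stdlib Require Import Reals Ranalysis5 Lra Psatz.
Open Scope R_scope.

(** * Algebra of the bisector equation: slope, uniqueness and necessary bounds *)

Definition bisector_eq (a b c l : R) : Prop :=
  l ^ 2 * (b + c) ^ 2 = b * c * ((b + c) ^ 2 - a ^ 2).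

(* For fixed [d = b + c - a], the length [l] given by [bisector_eq] increases with [b],
   and for fixed [b] it increases with [d]; so along a level curve of [l], [d] decreases
   as [b] grows. *)
Lemma bisector_eq_slope (c l a b a' b' : R) :
  0 < c -> 0 < l -> 0 < b -> b < b' -> 0 <= a -> 0 <= a' ->
  bisector_eq a b c l -> bisector_eq a' b' c l -> b' - b < a' - a.
Proof.
  unfold bisector_eq; intros hc hl hb hbb ha ha' E E'.
  destruct (Rlt_or_le (b' - b) (a' - a)) as [|H]; [assumption | exfalso].
  set (s := b + c) in *; set (s' := b' + c) in *.
  assert (hs : 0 < s) by (unfold s; lra).
  assert (hs' : 0 < s') by (unfold s'; lra).
  assert (hd : 0 < s - a).
  { assert (0 < l ^ 2 * s ^ 2) by (apply Rmult_lt_0_compat; apply pow_lt; lra).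
    assert (hbc : 0 < b * c) by (apply Rmult_lt_0_compat; assumption).
    assert (0 < s ^ 2 - a ^ 2) by (apply Rmult_lt_reg_l with (b * c); lra). nra. }
  set (d := s - a) in *.
  assert (hds : d <= s) by (unfold d; lra).
  (* Under the contrary assumption [s' - a'] is at least [d], and [x (2 s' - x)] increases in [x] up
     to [x = s']. *)
  assert (K1 : s' ^ 2 - a' ^ 2 >= d * (2 * s' - d)).
  { assert (d <= s' - a') by (unfold d, s, s' in *; lra).
    assert (d <= s') by lra. nra. }
  (* At fixed [d], [b (2 s - d) / s^2] increases strictly with [b]. The product in [P1] is the
     difference of the two sides, regrouped so that its sign follows from [0 < d <= s]. *)
  assert (K2 : b' * (2 * s' - d) * s ^ 2 > b * (2 * s - d) * s' ^ 2).
  { assert (P1 : 0 < (b' - b) * (d * (s ^ 2 + (b' - b) * (2 * s - b))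
        + (s - d) * 2 * (c * s + (b' - b) * c))).
    { apply Rmult_lt_0_compat; [lra|].
      assert (0 < s ^ 2 + (b' - b) * (2 * s - b)) by (unfold s; nra).
      assert (0 < c * s + (b' - b) * c) by nra. nra. }
    replace d with (s - a) in * by reflexivity. unfold s, s' in *. nra. }
  assert (K3 : l ^ 2 * s' ^ 2 >= b' * c * (d * (2 * s' - d))).
  { rewrite E'. apply Rmult_ge_compat_l; [nra | exact K1]. }
  assert (K4 : l ^ 2 * s ^ 2 = b * c * (d * (2 * s - d))) by (rewrite E; unfold d; ring).
  assert (K5 : l ^ 2 * s' ^ 2 * s ^ 2 >= b' * c * (d * (2 * s' - d)) * s ^ 2)
    by (apply Rmult_ge_compat_r; [nra | exact K3]).
  assert (K6 : 0 < (c * d) * (b' * (2 * s' - d) * s ^ 2 - b * (2 * s - d) * s' ^ 2))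
    by (apply Rmult_lt_0_compat; nra).
  nra.
Qed.

(** If [b < b'], the first equation makes [a] grow by more than [b] does; the second, with the roles
    exchanged, makes [b] grow by more than [a] does, a contradiction. *)
Lemma bisector_eq_unique (c l m a b a' b' : R) :
  0 < c -> 0 < l -> 0 < m -> 0 < a -> 0 < b -> 0 < a' -> 0 < b' ->
  bisector_eq a b c l -> bisector_eq b a c m ->
  bisector_eq a' b' c l -> bisector_eq b' a' c m -> a = a' /\ b = b'.
Proof.
  assert (W : forall a b a' b', 0 < c -> 0 < l -> 0 < m ->
    0 < a -> 0 < b -> 0 < a' -> 0 < b' ->
    bisector_eq a b c l -> bisector_eq b a c m ->
    bisector_eq a' b' c l -> bisector_eq b' a' c m -> ~ b < b').
  { clear; intros a b a' b' hc hl hm ha hb ha' hb' E F E' F' H.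
    assert (b' - b < a' - a) by (apply (bisector_eq_slope c l a b a' b'); auto with real).
    assert (a' - a < b' - b) by
      (apply (bisector_eq_slope c m b a b' a'); auto with real; lra).
    lra. }
  intros hc hl hm ha hb ha' hb' E F E' F'.
  assert (~ b < b') by (apply (W a b a' b'); assumption).
  assert (~ b' < b) by (apply (W a' b' a b); assumption).
  assert (~ a < a').
  { intro K. assert (a' - a < b' - b) by
      (apply (bisector_eq_slope c m b a b' a'); auto with real). lra. }
  assert (~ a' < a).
  { intro K. assert (a - a' < b - b') by
      (apply (bisector_eq_slope c m b' a' b a); auto with real). lra. }
  lra.
Qed.

(** For fixed [c] and [d = b + c - a], [l^2 = c d b (2 (b + c) - d) / (b + c)^2] increases with [b].
    The bounds are its limit [2 c d] at infinity and its value at the degenerate position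
    [b = d / 2], where [l = 2 c d / (2 c + d)]. *)
Lemma bisector_eq_bounds (a b c l : R) :
  0 < a -> 0 < b -> 0 < c -> 0 < l -> a < b + c -> c < a + b -> b < a + c ->
  bisector_eq a b c l ->
  l ^ 2 < 2 * c * (b + c - a) /\ 2 * c * (b + c - a) < l * (2 * c + (b + c - a)).
Proof.
  unfold bisector_eq; intros ha hb hc hl h1 h2 h3 E.
  remember (b + c - a) as d eqn:Hd.
  assert (a = b + c - d) by lra. subst a. clear Hd.
  assert (E1 : l ^ 2 * (b + c) ^ 2 = b * c * d * (2 * (b + c) - d)) by (rewrite E; ring).
  assert (hd : 0 < d) by lra. assert (hd2 : d < 2 * c) by lra.
  assert (hbd : d < 2 * b) by lra.
  assert (0 < (b + c) ^ 2) by nra.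
  split.
  - apply Rmult_lt_reg_r with ((b + c) ^ 2); [assumption|]. rewrite E1.
    assert (0 < c * d) by nra.
    assert (0 < (c * d) * (2 * (b + c) ^ 2 - b * (2 * (b + c) - d))) by
      (apply Rmult_lt_0_compat; nra).
    nra.
  - assert (K : (2 * c * d) ^ 2 * (b + c) ^ 2 < l ^ 2 * (b + c) ^ 2 * (2 * c + d) ^ 2).
    { rewrite E1.
      assert (Q : 0 < b * (2 * (b + c) - d) * (2 * c + d) ^ 2 - 4 * c * d * (b + c) ^ 2).
      (* [t] measures the excess over the degenerate position. In terms of it the difference is [t
         (2c + d) (4c^2 + d^2) + 2 t^2 (4c^2 + 2cd + d^2)]. *)
      { assert (exists t, b = d / 2 + t /\ 0 < t) as [t [-> ht]] by (exists (b - d / 2); lra).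
        assert (0 < t * c) by nra. assert (0 < t * d) by nra. nra. }
      assert (0 < (c * d) * (b * (2 * (b + c) - d) * (2 * c + d) ^ 2 - 4 * c * d * (b + c) ^ 2))
        by (apply Rmult_lt_0_compat; nra).
      nra. }
    assert (K2 : (2 * c * d) ^ 2 < (l * (2 * c + d)) ^ 2).
    { apply Rmult_lt_reg_r with ((b + c) ^ 2); [assumption|]. nra. }
    assert (0 < l * (2 * c + d)) by nra. nra.
Qed.

(** * Existence of the sides for [c = 1], by the intermediate value theorem *)

(** The curve [a = g(b)] for [c = 1]: the nonnegative root [a] of [bisector_eq a b 1 l] when
    [l^2 <= b]. For [0 < b < l^2] the radicand is negative and [sqrt] returns 0, which keeps the
    function monotone on all positive [b]. *)
Definition bisector_side (l b : R) : R := (b + 1) * sqrt (1 - l ^ 2 / b).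

Lemma bisector_side_nonneg (l b : R) : 0 < b -> 0 <= bisector_side l b.
Proof. intros; apply Rmult_le_pos; [lra | apply sqrt_pos]. Qed.

Lemma bisector_side_sqr (l b : R) : 0 < b -> l ^ 2 <= b ->
  b * bisector_side l b ^ 2 = (b + 1) ^ 2 * (b - l ^ 2).
Proof.
  intros hb hm; unfold bisector_side.
  rewrite Rpow_mult_distr, pow2_sqrt; [field; lra|].
  assert (l ^ 2 / b <= 1); [|lra].
  apply Rmult_le_reg_r with (1 := hb). unfold Rdiv.
  rewrite Rmult_assoc, Rinv_l; lra.
Qed.

Lemma bisector_side_eq (l b : R) : 0 < b -> l ^ 2 <= b ->
  bisector_eq (bisector_side l b) b 1 l.
Proof. intros hb hm; unfold bisector_eq. pose proof (bisector_side_sqr l b hb hm). lra. Qed.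

Lemma bisector_side_zero (l : R) : 0 < l -> bisector_side l (l ^ 2) = 0.
Proof.
  intros hl; unfold bisector_side.
  replace (1 - l ^ 2 / l ^ 2) with 0 by (field; lra). rewrite sqrt_0; ring.
Qed.

Lemma lt_bisector_side (l b a : R) : 0 < b -> l ^ 2 <= b -> 
  a ^ 2 * b < (b + 1) ^ 2 * (b - l ^ 2) -> a < bisector_side l b.
Proof.
  intros hb hm H. rewrite <- bisector_side_sqr in H by assumption.
  pose proof (bisector_side_nonneg l b hb).
  assert (a ^ 2 < bisector_side l b ^ 2) by (apply Rmult_lt_reg_l with b; lra). nra.
Qed.

Lemma bisector_side_lt (l b a : R) : 0 < b -> l ^ 2 <= b -> 0 <= a ->
  (b + 1) ^ 2 * (b - l ^ 2) < a ^ 2 * b -> bisector_side l b < a.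
Proof.
  intros hb hm ha H. rewrite <- bisector_side_sqr in H by assumption.
  assert (bisector_side l b ^ 2 < a ^ 2) by (apply Rmult_lt_reg_l with b; lra). nra.
Qed.

Lemma bisector_side_mono (l b b' : R) : 0 < l -> 0 < b -> b <= b' ->
  bisector_side l b <= bisector_side l b'.
Proof.
  intros hl hb H; unfold bisector_side.
  apply Rmult_le_compat; [lra | apply sqrt_pos | lra |].
  apply sqrt_le_1_alt. assert (l ^ 2 / b' <= l ^ 2 / b); [|lra].
  apply Rmult_le_compat_l; [nra|]. apply Rinv_le_contravar; assumption.
Qed.

Lemma continuity_bisector_side (l b : R) : 0 < b -> l ^ 2 <= b ->
  continuity_pt (bisector_side l) b.
Proof.
  intros hb hm.
  apply (continuity_pt_mult (fun b => b + 1) (fun b => sqrt (1 - l ^ 2 / b))).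
  - apply continuity_pt_plus; [apply derivable_continuous_pt, derivable_pt_id|].
    apply continuity_pt_const; intros ? ?; reflexivity.
  - apply (continuity_pt_comp (fun b => 1 - l ^ 2 / b) sqrt).
    + apply (continuity_pt_minus (fun _ => 1) (fun b => l ^ 2 / b)).
      * apply continuity_pt_const; intros ? ?; reflexivity.
      * apply (continuity_pt_div (fun _ => l ^ 2) id).
        -- apply continuity_pt_const; intros ? ?; reflexivity.
        -- apply derivable_continuous_pt, derivable_pt_id.
        -- unfold id; lra.
    (* At the endpoint [b = l^2] the radicand is 0; [sqrt] is continuous there from both sides,
       being 0 on negative reals. *)
    + apply continuity_pt_sqrt. assert (l ^ 2 / b <= 1); [|lra].
      apply Rmult_le_reg_r with (1 := hb). unfold Rdiv.
      rewrite Rmult_assoc, Rinv_l; lra.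
Qed.

Lemma continuity_pt_Rmax_l (m x : R) : continuity_pt (fun x => Rmax x m) x.
Proof.
  intros eps heps. exists eps; split; [exact heps|].
  intros y [_ H]. simpl in *. unfold Rdist in *.
  apply Rle_lt_trans with (2 := H).
  unfold Rmax, Rabs; destruct (Rle_dec y m), (Rle_dec x m);
    repeat destruct Rcase_abs; lra.
Qed.

(* [bisector_side l b = b + 1 - l ^ 2 / 2 + o(1)] as [b] grows. *)
Lemma lt_bisector_side_asymptotic (d r l b : R) :
  0 < l -> 0 < r <= 1 -> d = l ^ 2 / 2 + r -> d < 2 -> 10 <= b * r ->
  b + 1 - d < bisector_side l b.
Proof.
  intros hl hr hm hm2 hb.
  assert (10 <= b) by nra.
  assert (hl2 : 0 < l ^ 2) by nra.
  apply lt_bisector_side; try lra.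
  replace (l ^ 2) with (2 * d - 2 * r) by lra.
  (* The difference of the two sides is twice the expression of [H1], plus that of [H2], plus
     [12 b + 2 r - 2 d], which is positive since [b >= 10] and [d < 2]. *)
  assert (H1 : 0 <= (b * r - 10) * b) by (apply Rmult_le_pos; lra).
  assert (H2 : 0 <= ((2 - d) * (4 + d) + 4 * r) * b).
  { apply Rmult_le_pos; [|lra]. apply Rplus_le_le_0_compat; [|lra].
    apply Rmult_le_pos; lra. }
  nra.
Qed.

(** The intermediate value theorem is applied to [h(g(b)) - b] on [[b0, K]]. The last hypothesis
    controls the sign at [b0]; [l^2 + m^2 < 4] gives positivity at [K]. *)
Lemma bisector_sides_exist (l m : R) : 0 < l -> 0 < m -> l ^ 2 + m ^ 2 < 4 ->
  4 - 4 * (l + m) + 3 * (l * m) < 0 ->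
  exists a b, 0 < a /\ 0 < b /\ a < b + 1 /\ b < a + 1 /\ 1 < a + b /\
    bisector_eq a b 1 l /\ bisector_eq b a 1 m.
Proof.
  intros hl hm h4 hP.
  assert (hl2 : l < 2) by nra.
  assert (hlp : 0 < l ^ 2) by nra. assert (hmp : 0 < m ^ 2) by nra.
  (* [r] is chosen so that [l^2 / 2 + r] and [m^2 / 2 + r] add up to 2. [K = 20 / r] is large enough
     for the asymptotic bound both at [K] and at [K + 1 - d]. *)
  set (r := (4 - l ^ 2 - m ^ 2) / 4).
  assert (hr : 0 < r <= 1) by (unfold r; lra).
  set (K := 20 / r).
  assert (hK : K * r = 20) by (unfold K; field; lra).
  assert (hK20 : 20 <= K) by nra.
  (* At [b0] the curve [a = bisector_side l b] meets [a = |1 - b|]. *)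
  set (b0 := l / (2 - l)).
  assert (hb0 : b0 * (2 - l) = l) by (unfold b0; field; lra).
  assert (hb0p : 0 < b0) by (apply Rdiv_lt_0_compat; lra).
  assert (hlb0 : l ^ 2 <= b0).
  { apply Rmult_le_reg_r with (2 - l); [lra|]. rewrite hb0.
    (* The claim [l^2 (2 - l) <= l] is [0 <= l (l - 1)^2]. *)
    pose proof (Rmult_le_pos l ((l - 1) ^ 2) ltac:(lra) (pow2_ge_0 _)). lra. }
  assert (hb0K : b0 < K).
  { assert (r < 2 - l) by (unfold r; nra).
    apply Rmult_lt_reg_r with (2 - l); [lra|]. rewrite hb0.
    apply Rlt_trans with (K * r); [lra|]. apply Rmult_lt_compat_l; lra. }
  assert (hg0 : bisector_side l b0 = Rabs (1 - b0)).
  { apply Rsqr_inj; [now apply bisector_side_nonneg | apply Rabs_pos |].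
    rewrite <- Rsqr_abs, !Rsqr_pow2.
    apply Rmult_eq_reg_l with b0; [|lra].
    rewrite bisector_side_sqr by assumption.
    assert (El : l = 2 * b0 / (1 + b0)) by (field_simplify_eq; lra).
    rewrite El; field. lra. }
  (* [Rmax] keeps the argument in the domain [m ^ 2 <= a] of the second curve. *)
  set (f := fun b => bisector_side m (Rmax (bisector_side l b) (m ^ 2)) - b).
  assert (hf0 : f b0 < 0).
  { unfold f; rewrite hg0.
      assert (bisector_side m (Rmax (Rabs (1 - b0)) (m ^ 2)) < b0); [|lra].
      (* Three cases: the argument is clipped to [m^2], where the second curve is at 0;
         [a = b0 - 1], where the curve lies below [a + 1 = b0]; and [a = 1 - b0], where the claim
         reduces to [hmb], which is [hP] once multiplied by [2 - l]. *)
      unfold Rmax; destruct (Rle_dec (Rabs (1 - b0)) (m ^ 2)) as [H|H].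
      + rewrite bisector_side_zero; assumption.
      + apply Rnot_le_lt in H. apply bisector_side_lt; try lra.
        revert H; unfold Rabs; destruct (Rcase_abs (1 - b0)) as [C|C]; intros H.
        * replace (- (1 - b0) + 1) with b0 by ring.
          apply Rmult_lt_compat_l; [apply pow_lt|]; lra.
        * assert (hmb : 2 * (1 - b0) < m * (2 - b0)).
          { apply Rmult_lt_reg_r with (2 - l); [lra|].
            replace (2 * (1 - b0) * (2 - l)) with (2 * (2 - l - b0 * (2 - l))) by ring.
            replace (m * (2 - b0) * (2 - l)) with (m * (2 * (2 - l) - b0 * (2 - l))) by ring.
            rewrite hb0. lra. }
          assert ((2 * (1 - b0)) ^ 2 < (m * (2 - b0)) ^ 2) by
            (rewrite <- !Rsqr_pow2; apply Rsqr_incrst_1; lra).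
          lra.
    }
  destruct (IVT_interv f b0 K) as (b & [hb1 hb2] & hf); trivial.
  - intros b hb. unfold f.
    apply (continuity_pt_minus _ id); [|apply derivable_continuous_pt, derivable_pt_id].
    apply (continuity_pt_comp (fun b => Rmax (bisector_side l b) (m ^ 2)) (bisector_side m)).
    + apply (continuity_pt_comp (bisector_side l) (fun a => Rmax a (m ^ 2))).
      * apply continuity_bisector_side; lra.
      * apply continuity_pt_Rmax_l.
    + apply continuity_bisector_side; pose proof (Rmax_r (bisector_side l b) (m ^ 2)); lra.
  - unfold f. set (d := l ^ 2 / 2 + r). set (e := m ^ 2 / 2 + r).
    (* The first curve exceeds [K + 1 - d] at [K], and the second exceeds [(K + 1 - d) + 1 - e = K]
       at [K + 1 - d]. *)
    assert (hde : d + e = 2) by (unfold d, e, r; field).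
    assert (hd : 0 < d) by (unfold d; lra). assert (he : 0 < e) by (unfold e; lra).
    assert (H1 : K + 1 - d < bisector_side l K)
      by (apply (lt_bisector_side_asymptotic d r l K); trivial; unfold d, e in *; lra).
    assert (H2 : K < bisector_side m (K + 1 - d)).
    { replace K with ((K + 1 - d) + 1 - e) at 1 by lra.
      apply (lt_bisector_side_asymptotic e r m (K + 1 - d)); trivial; try lra.
      assert (0 <= r * (2 - d)) by (apply Rmult_le_pos; lra). lra. }
    assert (bisector_side m (K + 1 - d) <=
        bisector_side m (Rmax (bisector_side l K) (m ^ 2))); [|lra].
    apply bisector_side_mono; trivial; [lra|].
    pose proof (Rmax_l (bisector_side l K) (m ^ 2)); lra.
  - assert (hb : 0 < b) by lra. assert (hlb : l ^ 2 <= b) by lra.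
    assert (hbb : b0 < b).
    { destruct hb1 as [|<-]; [assumption | lra]. }
    unfold f in hf.
    (* Where the argument is clipped, [f b = - b < 0]; hence at the root the maximum is the side
       itself and both equations hold. *)
    assert (hma : m ^ 2 < bisector_side l b).
    { apply Rnot_le_lt; intros C. rewrite Rmax_right in hf by assumption.
      rewrite bisector_side_zero in hf; lra. }
    rewrite Rmax_left in hf by lra.
    pose proof (bisector_side_eq l b hb hlb) as E1.
    pose proof (bisector_side_eq m (bisector_side l b) ltac:(lra) ltac:(lra)) as E2.
    set (a := bisector_side l b) in *.
    replace (bisector_side m a) with b in E2 by lra.
    exists a, b. unfold bisector_eq in *.
    repeat split; trivial; try lra.
    + assert (0 < b * ((b + 1) ^ 2 - a ^ 2)) by nra.
      assert (0 < (b + 1) ^ 2 - a ^ 2) by (apply Rmult_lt_reg_l with b; lra). nra.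
    + assert (ha : 0 < a) by lra.
      assert (0 < a * ((a + 1) ^ 2 - b ^ 2)) by nra.
      assert (0 < (a + 1) ^ 2 - b ^ 2) by (apply Rmult_lt_reg_l with a; lra). nra.
    (* If [a <= 1 - b], the first equation gives [4 b^2 <= l^2 (b + 1)^2], hence [b (2 - l) <= l],
       that is [b <= b0], contrary to [hbb]. *)
    + apply Rnot_le_lt; intros C.
      assert (a ^ 2 <= (1 - b) ^ 2) by nra.
      assert (4 * b ^ 2 <= l ^ 2 * (b + 1) ^ 2) by nra.
      assert (2 * b <= l * (b + 1)).
      { apply Rsqr_incr_0; [rewrite !Rsqr_pow2; lra | lra |].
        apply Rmult_le_pos; lra. }
      assert (0 < (b - b0) * (2 - l)) by (apply Rmult_lt_0_compat; lra). lra.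
Qed.

(** * Plane geometry: from angles and bisectors to the bisector equation *)

Lemma distance_sqr (P Q : point) :
  distance P Q ^ 2 = (fst P - fst Q) ^ 2 + (snd P - snd Q) ^ 2.
Proof.
  unfold distance, dist_euc. rewrite pow2_sqrt; [unfold Rsqr; ring|].
  apply Rplus_le_le_0_compat; apply Rle_0_sqr.
Qed.

Lemma distance_nonneg (P Q : point) : 0 <= distance P Q.
Proof. apply sqrt_pos. Qed.

Lemma sqr_inj_nonneg (u v : R) : 0 <= u -> 0 <= v -> u ^ 2 = v ^ 2 -> u = v.
Proof. intros; apply Rsqr_inj; trivial; unfold Rsqr; nra. Qed.

Lemma distance_eq (P Q : point) (l : R) : 0 <= l ->
  (fst P - fst Q) ^ 2 + (snd P - snd Q) ^ 2 = l ^ 2 -> distance P Q = l.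
Proof.
  intros hl H; apply sqr_inj_nonneg; [apply distance_nonneg | exact hl |].
  now rewrite distance_sqr.
Qed.

Lemma distance_sym (P Q : point) : distance P Q = distance Q P.
Proof. apply distance_symm. Qed.

Lemma nondegenerate_rot (A B C : point) : nondegenerate A B C -> nondegenerate B C A.
Proof. unfold nondegenerate, collinear; intros H E; apply H; lra. Qed.

Lemma nondegenerate_distance (A B C : point) :
  nondegenerate A B C -> 0 < distance A B.
Proof.
  intros H. destruct (Rle_lt_or_eq_dec _ _ (distance_nonneg A B)) as [|E]; [assumption|].
  exfalso; apply H; unfold collinear.
  pose proof (distance_sqr A B) as S; rewrite <- E in S.
  pose proof (pow2_ge_0 (fst A - fst B)); pose proof (pow2_ge_0 (snd A - snd B)).
  assert (X : fst A - fst B = 0) by (apply Rsqr_0_uniq; unfold Rsqr; lra).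
  assert (Y : snd A - snd B = 0) by (apply Rsqr_0_uniq; unfold Rsqr; lra).
  replace (fst B - fst A) with 0 by lra. replace (snd B - snd A) with 0 by lra. ring.
Qed.

Lemma dot_distance (P Q S : point) :
  2 * dot P Q S = distance P Q ^ 2 + distance P S ^ 2 - distance Q S ^ 2.
Proof. rewrite !distance_sqr; unfold dot; ring. Qed.

(** Strict Cauchy-Schwarz: by Lagrange's identity the gap between the squares is the square of the
    cross product, nonzero for a non-degenerate triangle. *)
Lemma dot_lt (A B C : point) : nondegenerate A B C ->
  - (distance A B * distance A C) < dot A B C < distance A B * distance A C.
Proof.
  intros H.
  assert (K : dot A B C ^ 2 < (distance A B * distance A C) ^ 2).
  { replace ((distance A B * distance A C) ^ 2)
      with (distance A B ^ 2 * distance A C ^ 2) by ring.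
    rewrite !distance_sqr; unfold dot.
    assert (0 < ((fst B - fst A) * (snd C - snd A) - (snd B - snd A) * (fst C - fst A)) ^ 2).
    { rewrite <- Rsqr_pow2. apply Rlt_0_sqr; exact H. }
    nra. }
  assert (0 <= distance A B * distance A C) by
    (apply Rmult_le_pos; apply distance_nonneg).
  nra.
Qed.

Lemma triangle_strict (A B C : point) : nondegenerate A B C ->
  distance B C < distance A B + distance A C.
Proof.
  intros H. pose proof (dot_lt A B C H) as [L _].
  pose proof (dot_distance A B C). pose proof (distance_nonneg A B).
  pose proof (distance_nonneg A C). pose proof (distance_nonneg B C). nra.
Qed.

Lemma dot_quotient_bound (P Q S : point) : 0 < distance P Q -> 0 < distance P S ->
  -1 <= dot P Q S / (distance P Q * distance P S) <= 1.
Proof.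
  intros h1 h2. assert (h : 0 < distance P Q * distance P S) by nra.
  assert (K : dot P Q S ^ 2 <= (distance P Q * distance P S) ^ 2).
  { replace ((distance P Q * distance P S) ^ 2)
      with (distance P Q ^ 2 * distance P S ^ 2) by ring.
    rewrite !distance_sqr; unfold dot.
    pose proof (pow2_ge_0 ((fst Q - fst P) * (snd S - snd P) - (snd Q - snd P) * (fst S - fst P))).
    nra. }
  set (h0 := distance P Q * distance P S) in *.
  assert (E : dot P Q S / h0 * h0 = dot P Q S) by (field; lra).
  split; apply Rmult_le_reg_r with (1 := h); rewrite E; nra.
Qed.

(** Both quotients lie in [[-1, 1]], where [acos] is injective, so equal angles mean equal cosines;
    the common factor [distance A D] cancels. *)
Lemma angle_eq_iff (A B C D : point) :
  0 < distance A B -> 0 < distance A C -> 0 < distance A D ->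
  (angle B A D = angle D A C <->
   dot A B D * distance A C = dot A C D * distance A B).
Proof.
  intros hB hC hD; unfold angle.
  assert (S : dot A D C = dot A C D) by (unfold dot; ring).
  split; intros H.
  - apply (f_equal cos) in H; rewrite !cos_acos in H;
      try (apply dot_quotient_bound; trivial; now rewrite distance_sym).
    rewrite S in H.
    apply (f_equal (fun z => z * (distance A B * distance A C * distance A D))) in H.
    field_simplify in H; lra.
  - f_equal. rewrite S.
    apply Rmult_eq_reg_r with (distance A B * distance A C * distance A D); [|].
    + field_simplify; lra.
    + apply Rgt_not_eq; repeat apply Rmult_lt_0_compat; assumption.
Qed.

(** With the foot at parameter [t] on [BC], equality of the angles forces [t = c / (b + c)], and
    expanding [AD^2] at this [t] gives Stewart's formula. *)
Lemma bisector_length_iff (A B C : point) (l : R) : nondegenerate A B C ->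
  (bisector_length A B C l <->
   0 < l /\ bisector_eq (distance B C) (distance A C) (distance A B) l).
Proof.
  intros H.
  pose proof (nondegenerate_distance _ _ _ H) as hc.
  assert (hb : 0 < distance A C).
  { rewrite distance_sym. apply nondegenerate_distance with B.
    now apply nondegenerate_rot, nondegenerate_rot. }
  pose proof (dot_lt _ _ _ H) as [Hp1 Hp2].
  pose proof (dot_distance A B C) as Hp.
  assert (F : forall t, let D := ((1 - t) * fst B + t * fst C, (1 - t) * snd B + t * snd C) in
     dot A B D = (1 - t) * distance A B ^ 2 + t * dot A B C /\
     dot A C D = (1 - t) * dot A B C + t * distance A C ^ 2 /\
     distance A D ^ 2 = (1 - t) ^ 2 * distance A B ^ 2
       + 2 * t * (1 - t) * dot A B C + t ^ 2 * distance A C ^ 2).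
  { intros t D. rewrite !distance_sqr. unfold D, dot; simpl. repeat split; ring. }
  set (p := dot A B C) in *. set (c := distance A B) in *. set (b := distance A C) in *.
  assert (Ha : distance B C ^ 2 = b ^ 2 + c ^ 2 - 2 * p) by lra.
  unfold bisector_eq. rewrite Ha.
  assert (hbc : 0 < b * c) by nra.
  split.
  - intros (D & (t & ht & HD) & Hang & Hl).
    destruct (F t) as (F1 & F2 & F3). rewrite <- HD in F1, F2, F3.
    assert (hl : 0 < l).
    { destruct (Rle_lt_or_eq_dec _ _ (distance_nonneg A D)) as [|Z]; [lra|].
      rewrite <- Z in F3. exfalso.
      assert (0 <= (1 - t) * t) by nra.
      (* This expression equals [AD^2], so the foot differs from [A]; [p + b c] is positive by
         strict Cauchy-Schwarz. *)
      assert (0 < ((1 - t) * c - t * b) ^ 2 + 2 * (t * (1 - t)) * (p + b * c)); [|nra].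
      destruct (Req_dec (t * (1 - t)) 0) as [Z1|Z1].
      - rewrite Z1. apply Rmult_integral in Z1 as [Z1|Z1].
        + subst t. nra.
        + replace t with 1 by lra. nra.
      - pose proof (pow2_ge_0 ((1 - t) * c - t * b)).
        assert (0 < t * (1 - t)) by lra. nra. }
    split; [assumption|].
    apply angle_eq_iff in Hang; fold c; fold b; try lra.
    fold c in Hang; fold b in Hang. rewrite F1, F2 in Hang.
    (* The angle condition factors, and [b c - p] is positive, so the other factor determines
       [t]. *)
    assert (T : (b * c - p) * ((1 - t) * c - t * b) = 0) by (ring_simplify; ring_simplify in Hang; lra).
    apply Rmult_integral in T as [T|T]; [lra|].
    assert (Ht : t = c / (b + c)) by (field_simplify_eq; lra).
    rewrite <- Hl, F3, Ht. field. lra.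
  - intros (hl & E).
    set (t := c / (b + c)).
    destruct (F t) as (F1 & F2 & F3).
    exists ((1 - t) * fst B + t * fst C, (1 - t) * snd B + t * snd C).
    set (D := ((1 - t) * fst B + t * fst C, (1 - t) * snd B + t * snd C)) in *.
    assert (Hl : distance A D = l).
    { apply sqr_inj_nonneg; [apply distance_nonneg | lra |].
      rewrite F3. apply Rmult_eq_reg_r with ((b + c) ^ 2); [|nra].
      rewrite E. unfold t. field. lra. }
    split; [|split]; [| |assumption].
    + exists t; split; [|reflexivity].
      unfold t; split; [apply Rlt_le, Rdiv_lt_0_compat; lra|].
      apply Rmult_le_reg_r with (b + c); [lra|]. field_simplify; lra.
    + apply angle_eq_iff; fold c; fold b; try lra.
      rewrite F1, F2. unfold t. field. lra.
Qed.

(** * Triangles with prescribed sides, and congruence by three sides *)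

Lemma triangle_exists (a b c : R) :
  0 < a -> 0 < b -> 0 < c -> a < b + c -> b < a + c -> c < a + b ->
  exists A B C : point, nondegenerate A B C /\
    distance A B = c /\ distance A C = b /\ distance B C = a.
Proof.
  intros ha hb hc h1 h2 h3.
  (* With [A] at the origin and [B] on the first axis, the law of cosines gives the abscissa [p] of
     [C]. *)
  set (p := (b ^ 2 + c ^ 2 - a ^ 2) / (2 * c)).
  assert (hp : 2 * c * p = b ^ 2 + c ^ 2 - a ^ 2) by (unfold p; field; lra).
  assert (hpos : 0 < b ^ 2 - p ^ 2).
  (* The factors are [a^2 - (b - c)^2] and [(b + c)^2 - a^2], as in Heron's formula. *)
  { assert (0 < (2 * c * b - 2 * c * p) * (2 * c * b + 2 * c * p)).
    { rewrite hp. apply Rmult_lt_0_compat; nra. }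
    assert (0 < c ^ 2) by nra. nra. }
  set (q := sqrt (b ^ 2 - p ^ 2)).
  assert (hq : 0 < q) by (apply sqrt_lt_R0; assumption).
  assert (hq2 : q ^ 2 = b ^ 2 - p ^ 2) by (apply pow2_sqrt; lra).
  exists (0, 0), (c, 0), (p, q). repeat split.
  - unfold nondegenerate, collinear; simpl. nra.
  - apply distance_eq; simpl; lra.
  - apply distance_eq; simpl; lra.
  - apply distance_eq; simpl; lra.
Qed.

(** Equal sides give equal inner products of the edge vectors at [A] and [A'], hence cross products
    equal up to a sign [s], which records the orientation. *)
Lemma sss_congruent (A B C A' B' C' : point) : nondegenerate A B C ->
  distance A B = distance A' B' -> distance A C = distance A' C' ->
  distance B C = distance B' C' -> congruent_triangles A B C A' B' C'.
Proof.
  intros H HAB HAC HBC.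
  pose proof (nondegenerate_distance _ _ _ H) as hc.
  destruct A as [xa ya], B as [xb yb], C as [xc yc],
    A' as [xa' ya'], B' as [xb' yb'], C' as [xc' yc'].
  apply (f_equal (fun z => z ^ 2)) in HAB, HAC, HBC.
  rewrite !distance_sqr in HAB, HAC, HBC; simpl fst in *; simpl snd in *.
  assert (hk : 0 < (xb - xa) ^ 2 + (yb - ya) ^ 2).
  { pose proof (pow_lt _ 2 hc) as K. rewrite distance_sqr in K. simpl fst in K; simpl snd in K. lra. }
  clear hc H.
  remember (xb - xa) as u1. remember (yb - ya) as u2.
  remember (xc - xa) as v1. remember (yc - ya) as v2.
  remember (xb' - xa') as w1. remember (yb' - ya') as w2.
  remember (xc' - xa') as z1. remember (yc' - ya') as z2.
  assert (E1 : w1 ^ 2 + w2 ^ 2 = u1 ^ 2 + u2 ^ 2) by (subst; lra).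
  assert (E2 : z1 ^ 2 + z2 ^ 2 = v1 ^ 2 + v2 ^ 2) by (subst; lra).
  assert (E3 : w1 * z1 + w2 * z2 = u1 * v1 + u2 * v2) by (subst; lra).
  assert (E4 : exists s, s ^ 2 = 1 /\ w1 * z2 - w2 * z1 = s * (u1 * v2 - u2 * v1)).
  { assert (S : (w1 * z2 - w2 * z1) ^ 2 = (u1 * v2 - u2 * v1) ^ 2).
    { replace ((w1 * z2 - w2 * z1) ^ 2)
        with ((w1 ^ 2 + w2 ^ 2) * (z1 ^ 2 + z2 ^ 2) - (w1 * z1 + w2 * z2) ^ 2) by ring.
      rewrite E1, E2, E3. ring. }
    assert (T : ((w1 * z2 - w2 * z1) - (u1 * v2 - u2 * v1)) *
                ((w1 * z2 - w2 * z1) + (u1 * v2 - u2 * v1)) = 0) by lra.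
    apply Rmult_integral in T as [T|T]; [exists 1 | exists (-1)]; lra. }
  destruct E4 as (s & hs & E4).
  set (k := u1 ^ 2 + u2 ^ 2) in *.
  (* [X] and [s Y] are the coordinates of [P - A] along [AB] and its quarter turn; the image uses
     [X] and [Y] along [A'B'] and its quarter turn, a reflection being included when [s = -1]. *)
  exists (fun P =>
    let X := ((fst P - xa) * u1 + (snd P - ya) * u2) / k in
    let Y := s * ((snd P - ya) * u1 - (fst P - xa) * u2) / k in
    (xa' + X * w1 - Y * w2, ya' + X * w2 + Y * w1)).
  split; [|split; [|split]].
  - intros [x y] [x' y']. apply distance_eq; [apply distance_nonneg|].
    rewrite distance_sqr; simpl fst; simpl snd.
    transitivity (((((x - x') * u1 + (y - y') * u2) / k) ^ 2 +
        s ^ 2 * (((y - y') * u1 - (x - x') * u2) / k) ^ 2) * (w1 ^ 2 + w2 ^ 2)).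
    { field. lra. }
    rewrite E1, hs. unfold k. field. unfold k in hk; lra.
  - simpl. f_equal; field; lra.
  - simpl. rewrite <- Hequ1, <- Hequ2. f_equal.
    + transitivity (xa' + w1); [unfold k; field; unfold k in hk; lra | lra].
    + transitivity (ya' + w2); [unfold k; field; unfold k in hk; lra | lra].
  - simpl. rewrite <- Heqv1, <- Heqv2. 
    replace (v1 * u1 + v2 * u2) with (w1 * z1 + w2 * z2) by lra.
    replace (s * (v2 * u1 - v1 * u2)) with (w1 * z2 - w2 * z1) by lra.
    rewrite <- E1 in *. f_equal.
    + transitivity (xa' + z1); [field; lra | lra].
    + transitivity (ya' + z2); [field; lra | lra].
Qed.

(** * Triangles with given bisectors: existence, bounds and uniqueness *)

Lemma bisector_eq_scale (k a b c l : R) :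
  bisector_eq a b c l -> bisector_eq (k * a) (k * b) (k * c) (k * l).
Proof.
  unfold bisector_eq; intros E.
  transitivity (k ^ 4 * (l ^ 2 * (b + c) ^ 2)); [ring | rewrite E; ring].
Qed.

Lemma triangle_with_iff (la lb c : R) (A B C : point) : nondegenerate A B C ->
  (triangle_with la lb c A B C <->
   0 < la /\ 0 < lb /\ distance A B = c /\
   bisector_eq (distance B C) (distance A C) c la /\
   bisector_eq (distance A C) (distance B C) c lb).
Proof.
  intros H; unfold triangle_with.
  rewrite (bisector_length_iff A B C la) by assumption.
  rewrite (bisector_length_iff B C A lb) by now apply nondegenerate_rot.
  rewrite (distance_sym C A), (distance_sym B A).
  (* The equation is symmetric in the two sides at the vertex; this puts [AB] in third place for
     both bisectors. *)
  assert (S : bisector_eq (distance A C) (distance A B) (distance B C) lb <->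
    bisector_eq (distance A C) (distance B C) (distance A B) lb)
    by (unfold bisector_eq; split; intros; lra).
  rewrite S. split.
  - intros (_ & [h1 h2] & [h3 h4] & <-); auto.
  - intros (h1 & h3 & <- & h2 & h4); auto.
Qed.

Lemma triangle_sides (A B C : point) : nondegenerate A B C ->
  0 < distance B C /\ 0 < distance A C /\ 0 < distance A B /\
  distance B C < distance A C + distance A B /\
  distance A C < distance B C + distance A B /\
  distance A B < distance B C + distance A C.
Proof.
  intros H.
  pose proof (nondegenerate_rot _ _ _ H) as H'.
  pose proof (nondegenerate_rot _ _ _ H') as H''.
  pose proof (triangle_strict _ _ _ H). pose proof (triangle_strict _ _ _ H').
  pose proof (triangle_strict _ _ _ H'').
  pose proof (nondegenerate_distance _ _ _ H).
  pose proof (nondegenerate_distance _ _ _ H').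
  pose proof (nondegenerate_distance _ _ _ H'').
  rewrite (distance_sym C A), (distance_sym B A), (distance_sym C B) in *.
  lra.
Qed.

Lemma triangle_with_exists (la lb c : R) : 0 < la -> 0 < lb -> 0 < c ->
  la ^ 2 + lb ^ 2 < 4 * c ^ 2 ->
  4 * c ^ 2 - 4 * c * (la + lb) + 3 * (la * lb) < 0 ->
  exists A B C : point, triangle_with la lb c A B C.
Proof.
  intros hla hlb hc h1 h2.
  (* The equation is homogeneous of degree 4, so the problem is solved for [c = 1] and scaled
     back. *)
  destruct (bisector_sides_exist (la / c) (lb / c))
    as (a & b & ha & hb & t1 & t2 & t3 & E1 & E2).
  - apply Rdiv_lt_0_compat; assumption.
  - apply Rdiv_lt_0_compat; assumption.
  - apply Rmult_lt_reg_r with (c ^ 2); [apply pow_lt; assumption|].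
    replace (((la / c) ^ 2 + (lb / c) ^ 2) * c ^ 2) with (la ^ 2 + lb ^ 2)
      by (field; lra). assumption.
  - apply Rmult_lt_reg_r with (c ^ 2); [apply pow_lt; assumption|].
    replace ((4 - 4 * (la / c + lb / c) + 3 * (la / c * (lb / c))) * c ^ 2)
      with (4 * c ^ 2 - 4 * c * (la + lb) + 3 * (la * lb)) by (field; lra). lra.
  - destruct (triangle_exists (c * a) (c * b) c) as (A & B & C & H & e1 & e2 & e3);
      try nra.
    exists A, B, C. apply triangle_with_iff; [assumption|].
    rewrite e1, e2, e3.
    apply (bisector_eq_scale c) in E1, E2.
    replace (c * (la / c)) with la in E1 by (field; lra).
    replace (c * (lb / c)) with lb in E2 by (field; lra).
    rewrite Rmult_1_r in E1, E2. auto.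
Qed.

Lemma triangle_with_bounds (la lb c : R) (A B C : point) :
  triangle_with la lb c A B C ->
  0 < la /\ 0 < lb /\ 0 < c /\ la ^ 2 + lb ^ 2 < 4 * c ^ 2 /\
  4 * c ^ 2 - 4 * c * (la + lb) + 3 * (la * lb) < 0.
Proof.
  intros T. pose proof (proj1 T) as H.
  apply triangle_with_iff in T as (hla & hlb & <- & E1 & E2); [|assumption].
  destruct (triangle_sides _ _ _ H) as (ha & hb & hc & t1 & t2 & t3).
  apply bisector_eq_bounds in E1 as [U1 L1]; try lra.
  apply bisector_eq_bounds in E2 as [U2 L2]; try lra.
  set (a := distance B C) in *; set (b := distance A C) in *;
    set (c := distance A B) in *.
  assert (Hd : exists d, b + c - a = d /\ a + c - b = 2 * c - d /\ 0 < d < 2 * c)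
    by (exists (b + c - a); lra).
  destruct Hd as (d & D1 & D2 & hd). rewrite D1, D2 in *.
  repeat split; trivial; [nra|].
  (* Since [d] and [2 c - d] are below [2 c], the upper bounds [U1] and [U2] exclude [la >= 2 c] and
     [lb >= 2 c]. *)
  destruct (Rle_or_lt (2 * c) la); [nra|]. destruct (Rle_or_lt (2 * c) lb); [nra|].
  (* Multiplying by [2c - la] and [2c - lb] turns the lower bounds into bounds on [d]. *)
  assert (d * (2 * c - la) * (2 * c - lb) < 2 * c * la * (2 * c - lb)) by
    (apply Rmult_lt_compat_r; lra).
  assert ((2 * c - d) * (2 * c - lb) * (2 * c - la) < 2 * c * lb * (2 * c - la)) by
    (apply Rmult_lt_compat_r; lra).
  apply Rmult_lt_reg_l with c; [assumption|]. lra.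
Qed.

Lemma triangle_with_unique (la lb c : R) (A B C A' B' C' : point) :
  triangle_with la lb c A B C -> triangle_with la lb c A' B' C' ->
  congruent_triangles A B C A' B' C'.
Proof.
  intros T T'. pose proof (proj1 T) as H. pose proof (proj1 T') as H'.
  apply triangle_with_iff in T as (hla & hlb & Ec & E1 & E2); [|assumption].
  apply triangle_with_iff in T' as (_ & _ & Ec' & E1' & E2'); [|assumption].
  destruct (triangle_sides _ _ _ H) as (ha & hb & hc & _).
  destruct (triangle_sides _ _ _ H') as (ha' & hb' & _).
  rewrite Ec in hc.
  destruct (bisector_eq_unique c la lb (distance B C) (distance A C)
    (distance B' C') (distance A' C')); trivial.
  apply sss_congruent; trivial; congruence.
Qed.

Theorem mainTheorem6 (l1 l2 x : R) (hl2 : 0 < l2) (hl21 : l2 <= l1) :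
  let c_star := / 2 * (l1 + l2 + sqrt (l1 ^ 2 + l2 ^ 2 - l1 * l2)) in
  let c_star_star := / 2 * sqrt (l1 ^ 2 + l2 ^ 2) in
  (c_star_star < x < c_star ->
     (exists A B C : point, triangle_with l2 l1 x A B C) /\
     (forall A B C A' B' C' : point,
        triangle_with l2 l1 x A B C -> triangle_with l2 l1 x A' B' C' ->
        congruent_triangles A B C A' B' C')) /\
  (~ (c_star_star < x < c_star) ->
     ~ exists A B C : point, triangle_with l2 l1 x A B C).
Proof.
  intros c_star c_star_star.
  assert (hp : 0 <= l1 * l2) by (apply Rmult_le_pos; lra).
  assert (hq : l2 ^ 2 <= l1 ^ 2 + l2 ^ 2 - l1 * l2) by nra.
  assert (hr : 0 <= l1 ^ 2 + l2 ^ 2) by nra.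
  pose proof (sqrt_pos (l1 ^ 2 + l2 ^ 2 - l1 * l2)) as q0.
  pose proof (sqrt_pos (l1 ^ 2 + l2 ^ 2)) as r0.
  pose proof (pow2_sqrt (l1 ^ 2 + l2 ^ 2 - l1 * l2) ltac:(nra)) as q2.
  pose proof (pow2_sqrt _ hr) as r2.
  unfold c_star, c_star_star.
  set (q := sqrt (l1 ^ 2 + l2 ^ 2 - l1 * l2)) in *.
  set (r := sqrt (l1 ^ 2 + l2 ^ 2)) in *.
  split.
  - intros [h1 h2]. split; [|apply triangle_with_unique].
    assert (r ^ 2 < (2 * x) ^ 2) by nra.
    (* [l1 + l2 - q] is below [l1], so [x] is beyond the smaller root of the quadratic. *)
    assert (l2 <= q) by nra.
    assert (l1 < 2 * x) by nra.
    (* The product is [q^2 - (2 x - (l1 + l2))^2], the negative of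
       [4 x^2 - 4 x (l1 + l2) + 3 l1 l2]; thus [l1 + l2 - q] and [l1 + l2 + q] are the roots in
       [2 x]. *)
    assert (0 < (2 * x - (l1 + l2 - q)) * (l1 + l2 + q - 2 * x)) by
      (apply Rmult_lt_0_compat; lra).
    apply triangle_with_exists; lra.
  - intros N (A & B & C & T); apply N.
    apply triangle_with_bounds in T as (_ & _ & hx & h1 & h2).
    split; [nra|].
    assert ((2 * x - (l1 + l2)) ^ 2 < q ^ 2) by lra. nra.
Qed.
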